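(* Let $D$ be an integral domain, $K$ a field containing $D$ as a subring, $\mathcal{X}$ a projective model of $K$ over $D$, and $D^{*}=\bigcap_{R\in\mathcal{X}}R(t)$. Then the assignment $$\{\text{ideals on }\mathcal{X}\}\longrightarrow\{\text{relevant ideals of }D^{*}\},\qquad \mathcal{I}\longmapsto\bigcap_{R\in\mathcal{X}}(\mathcal{I}R)R(t)$$ is a well-defined bijection, with inverse $I\mapsto\mathcal{I}$, where $\mathcal{I}R=IR(t)\cap R$ for every $R\in\mathcal{X}$.
   Context: Rings are commutative with identity; local rings need not be Noetherian; $t$ is an indeterminate. $\mathcal{L}(K/D)$ is the set of local domains $R$ with $D\subseteq R\subseteq K$ and fraction field $K$. For an integral domain $A$, $\mathcal{S}(A)=\{A_P : P\text{ a prime ideal of }A\}$ (subrings of the fraction field of $A$). A premodel of $K$ over $D$ is a nonempty subset of $\mathcal{L}(K/D)$. For $H\subseteq K$ containing a nonzero element, $\mathcal{W}(D;H)=\bigcup_{0\ne x\in H}\mathcal{S}(D[Hx^{-1}])$, where $D[Hx^{-1}]$ is the subring of $K$ generated by $D$ and all $yx^{-1}$, $y\in H$. A projective model of $K$ over $D$ is a premodel of $K$ over $D$ of the form $\mathcal{W}(D;H)$ with $H\subseteq K$ finite and containing a nonzero element. An affine ring over $D$ is a subring of $K$ containing $D$ that is finitely generated as a $D$-algebra. $\operatorname{Aff}(\mathcal{X})$ is the set of affine rings $A$ over $D$ with $\mathcal{S}(A)\subseteq\mathcal{X}$. A preideal on $\mathcal{X}$ is a function $\mathcal{I}$ assigning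 to each $R\in\mathcal{X}$ an ideal $\mathcal{I}R$ of $R$. For a subring $A\subseteq K$ with $\mathcal{S}(A)\subseteq\mathcal{X}$, $A\cap\mathcal{I}:=\bigcap_{R\in\mathcal{S}(A)}\mathcal{I}R$. A preideal $\mathcal{I}$ is an ideal on $\mathcal{X}$ if $\mathcal{I}R=(A\cap\mathcal{I})R$ for all $A\in\operatorname{Aff}(\mathcal{X})$ and all $R\in\mathcal{S}(A)$. A polynomial in $R[t]$ is primitive if its coefficients generate the unit ideal of $R$. The Nagata extension $R(t)$ is the localization of $R[t]$ at the multiplicative set of primitive polynomials; for $R\in\mathcal{X}$ it is viewed inside $K(t)$. An ideal $J$ of $R(t)$ is relevant if $J=(J\cap R)R(t)$. An ideal $J$ of $D^{*}$ is relevant if $JR(t)$ is a relevant ideal of $R(t)$ for every $R\in\mathcal{X}$. *)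

(* Defs.v *)
From HB Require Import structures.
From mathcomp Require Import all_boot all_order all_algebra.
From mathcomp Require Import all_classical.

Set Implicit Arguments.
Unset Strict Implicit.
Unset Printing Implicit Defensive.

Import GRing.Theory.
Local Open Scope classical_set_scope.
Local Open Scope ring_scope.

(* Subrings of a field F, and their ideals, are Prop-valued subsets of F; they
   need not be decidable.  F is either K or K(t) below. *)

Definition is_subring (F : fieldType) (A : set F) : Prop :=
  subring_closed [in A].

(* I = A is allowed. *)
Definition is_ideal (F : fieldType) (A I : set F) : Prop :=
  [/\ I `<=` A, I 0,
      (forall x y, I x -> I y -> I (x + y)) &
      (forall a x, A a -> I x -> I (a * x))].

Definition prime_ideal (F : fieldType) (A P : set F) : Prop :=
  [/\ is_ideal A P, P <> A &
      forall x y, A x -> A y -> P (x * y) -> P x \/ P y].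

Definition maximal_ideal (F : fieldType) (A M : set F) : Prop :=
  [/\ is_ideal A M, M <> A &
      forall J, is_ideal A J -> M `<=` J -> J = M \/ J = A].

Definition is_local (F : fieldType) (A : set F) : Prop :=
  exists! M, maximal_ideal A M.

(* For an ideal J of a subring of A, this is the extension JA. *)
Definition ideal_gen (F : fieldType) (A J : set F) : set F :=
  smallest (is_ideal A) J.

Definition adjoin (F : fieldType) (D G : set F) : set F :=
  smallest (@is_subring F) (D `|` G).

Definition frac_field (F : fieldType) (A : set F) : set F :=
  [set a / b | a in A & b in A `\ 0].

Definition localization (F : fieldType) (A P : set F) : set F :=
  [set a / s | a in A & s in A `\` P].

(* The set S(A) of the localizations of A at its prime ideals. *)
Definition loc_set (F : fieldType) (A : set F) : set (set F) :=
  [set localization A P | P in prime_ideal A].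

(* The set L(K/D). *)
Definition local_domains (K : fieldType) (D : set K) : set (set K) :=
  [set R | [/\ is_subring R, is_local R, D `<=` R & frac_field R = [set: K]]].

Definition premodel (K : fieldType) (D : set K) (X : set (set K)) : Prop :=
  X !=set0 /\ X `<=` local_domains D.

(* The set W(D; H). *)
Definition blowup_set (K : fieldType) (D H : set K) : set (set K) :=
  \bigcup_(x in H `\ 0) loc_set (adjoin D [set y / x | y in H]).

Definition projective_model (K : fieldType) (D : set K) (X : set (set K)) :
    Prop :=
  premodel D X /\
  exists H : set K, [/\ finite_set H, H `\ 0 !=set0 & X = blowup_set D H].

Definition affine_ring (K : fieldType) (D A : set K) : Prop :=
  exists2 G : set K, finite_set G & A = adjoin D G.

Definition Aff (K : fieldType) (D : set K) (X : set (set K)) : set (set K) :=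
  [set A | affine_ring D A /\ loc_set A `<=` X].

(* A preideal is a function on the type of the elements of X, so that two
   preideals are equal as soon as they agree on X. *)
Definition preideal (K : fieldType) (X : set (set K)) (I : X -> set K) : Prop :=
  forall R : X, is_ideal (val R) (I R).

(* A `&` I, for a subring A such that S(A) is contained in X. *)
Definition preideal_meet (K : fieldType) (X : set (set K)) (I : X -> set K)
    (A : set K) : set K :=
  \bigcap_(R in [set R : X | loc_set A (val R)]) I R.

Definition ideals_on (K : fieldType) (D : set K) (X : set (set K)) :
    set (X -> set K) :=
  [set I : X -> set K | preideal I /\
    forall (A : set K) (R : X), Aff D X A -> loc_set A (val R) ->
      I R = ideal_gen (val R) (preideal_meet I A)].

Notation ratfrac K := {fraction {poly K}}.

Definition ratC (K : fieldType) (x : K) : ratfrac K := tofrac x%:P.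

Definition polys (K : fieldType) (R : set K) : set {poly K} :=
  [set p | p \is a polyOver [in R]].

Definition primitive_polys (K : fieldType) (R : set K) : set {poly K} :=
  [set q | polys R q /\ ideal_gen R [set c | c \in (q : seq K)] = R].

Definition nagata (K : fieldType) (R : set K) : set (ratfrac K) :=
  [set tofrac p / tofrac q | p in polys R & q in primitive_polys R].

(* The ring D^*. *)
Definition nagata_meet (K : fieldType) (X : set (set K)) : set (ratfrac K) :=
  \bigcap_(R in X) nagata R.

Definition relevant_nagata (K : fieldType) (R : set K) (J : set (ratfrac K)) :
    Prop :=
  is_ideal (nagata R) J /\
  J = ideal_gen (nagata R) (J `&` (@ratC K @` R)).

Definition relevant_ideals (K : fieldType) (X : set (set K)) :
    set (set (ratfrac K)) :=
  [set J | is_ideal (nagata_meet X) J /\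
    forall R, X R -> relevant_nagata R (ideal_gen (nagata R) J)].

Definition ideal_to_nagata (K : fieldType) (X : set (set K))
    (I : X -> set K) : set (ratfrac K) :=
  \bigcap_(R in [set: X]) ideal_gen (nagata (val R)) (@ratC K @` I R).

Definition nagata_to_ideal (K : fieldType) (X : set (set K))
    (J : set (ratfrac K)) : X -> set K :=
  fun R => (@ratC K @^-1` ideal_gen (nagata (val R)) J) `&` val R.

Arguments ideals_on {K} D X.
Arguments ideal_to_nagata {K} X I.
Arguments nagata_to_ideal {K} X J R.

(* Main.v *)
(* Let H = {x_0, ..., x_n} be the finite set that defines X = W(D; H), put
   A_i = D[H / x_i] and f = x_0 + x_1 t + ... + x_n t^n.  Over each ring
   R in S(A_i) the polynomial f / x_i is primitive, so the elements
   u_i = x_i / f lie in D^* and u_i is a unit of R(t).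

   If I is an ideal on X and a is in the intersection of A_i and I, then for each
   j some power of x_i / x_j multiplies a into the intersection of A_j and I;
   hence some power of u_i multiplies a into J, the ideal of D^* attached to I.
   Therefore J R(t) = (I R) R(t) for R in S(A_i), which contracts to I R.

   Conversely let J be an ideal of D^* and let z lie in every J R(t).  The
   coefficients of the polynomials q in A_i[t] such that q z u_i^m is in J for some
   m form an ideal of A_i that lies in no prime, so some q_i among them has a
   coefficient 1.  The sum Q of the polynomials x_i^m q_i, shifted to disjoint
   supports, satisfies z Q / f^m in J, and Q / f^m is a unit of every R(t), hence
   of D^*; so z is in J.  Relevance of J and McCoy's theorem show in the same way
   that the contractions of the ideals J R(t) form an ideal on X. *)
Require Import Defs.
From mathcomp Require Import all_boot all_order all_algebra.
From mathcomp Require Import all_classical.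
From mathcomp Require Import ring zify.

Set Implicit Arguments.
Unset Strict Implicit.
Unset Printing Implicit Defensive.

Import GRing.Theory.
Local Open Scope classical_set_scope.
Local Open Scope ring_scope.

(** * Subrings of a field and their ideals *)

Section Subrings.
Variable F : fieldType.
Implicit Types A B I J M P S : set F.

(** Applied in K(t): a denominator [q] of [x] yields the denominator [c * g * q] of [p / g * x]. *)
Lemma mulr_cancel_denom (c g p q x : F) : g != 0 ->
  c * g * q * (p / g * x) = c * p * (q * x).
Proof. by move=> g0; field. Qed.

Lemma is_subringP A : is_subring A <->
  [/\ A 1, (forall x y, A x -> A y -> A (x - y)) &
      (forall x y, A x -> A y -> A (x * y))].
Proof.
split=> [[h1 hB hM]|[h1 hB hM]].
- split; first exact: set_mem.
  + by move=> x y /mem_set hx /mem_set hy; apply: set_mem; apply: hB.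
  + by move=> x y /mem_set hx /mem_set hy; apply: set_mem; apply: hM.
- split; first exact: mem_set.
  + by move=> x y /set_mem hx /set_mem hy; apply: mem_set; apply: hB.
  + by move=> x y /set_mem hx /set_mem hy; apply: mem_set; apply: hM.
Qed.

Lemma subring1 A : is_subring A -> A 1.
Proof. by move=> /is_subringP[]. Qed.

Lemma subringB A x y : is_subring A -> A x -> A y -> A (x - y).
Proof. by move=> /is_subringP[_ h _]; apply: h. Qed.

Lemma subringM A x y : is_subring A -> A x -> A y -> A (x * y).
Proof. by move=> /is_subringP[_ _]; apply. Qed.

Lemma subring0 A : is_subring A -> A 0.
Proof. by move=> h; rewrite -(subrr 1); apply: subringB=> //; apply: subring1. Qed.

Lemma subringN A x : is_subring A -> A x -> A (- x).
Proof. by move=> h hx; rewrite -sub0r; apply: subringB=> //; apply: subring0. Qed.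

Lemma subringD A x y : is_subring A -> A x -> A y -> A (x + y).
Proof. by move=> h hx hy; rewrite -[y]opprK; apply: subringB=> //; apply: subringN. Qed.

Lemma subringX A x n : is_subring A -> A x -> A (x ^+ n).
Proof.
by move=> h hx; elim: n => [|n ih]; [exact: subring1|rewrite exprS; exact: subringM].
Qed.

Lemma bigcap_subring (T : Type) (C : set T) (B : T -> set F) :
  (forall i, C i -> is_subring (B i)) -> is_subring (\bigcap_(i in C) B i).
Proof.
move=> h; apply/is_subringP; split.
- by move=> i /h; apply: subring1.
- by move=> x y hx hy i hi; apply: subringB; [exact: h|exact: hx|exact: hy].
- by move=> x y hx hy i hi; apply: subringM; [exact: h|exact: hx|exact: hy].
Qed.

Lemma subring_adjoin (D G : set F) : is_subring (adjoin D G).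
Proof. by apply: (@bigcap_subring _ _ id) => A []. Qed.

Lemma sub_adjoin (D G : set F) : D `|` G `<=` adjoin D G.
Proof. exact: sub_gen_smallest. Qed.

Lemma is_ideal_refl A : is_subring A -> is_ideal A A.
Proof.
move=> hA; split=> //; first exact: subring0.
- by move=> x y; apply: subringD.
- by move=> x y; apply: subringM.
Qed.

Lemma idealN A I x : is_subring A -> is_ideal A I -> I x -> I (- x).
Proof.
move=> hA [_ _ _ hM] hx; rewrite -mulN1r; apply: hM => //.
by apply: subringN => //; apply: subring1.
Qed.

Lemma is_ideal_gen A J : is_subring A -> J `<=` A -> is_ideal A (ideal_gen A J).
Proof.
move=> hA hJ; split.
- by apply: smallest_sub => //; exact: is_ideal_refl.
- by move=> I [[]].
- by move=> x y hx hy I [hI hJI]; have [_ _ h _] := hI; apply: h; [exact: hx|exact: hy].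
- by move=> a x ha hx I [hI hJI]; have [_ _ _ h] := hI; apply: h => //; exact: hx.
Qed.

Lemma prime_ideal_ideal A P : prime_ideal A P -> is_ideal A P.
Proof. by case. Qed.

Lemma ideal_proper1 A I : is_ideal A I -> I <> A -> ~ I 1.
Proof.
move=> [h0 _ _ hM] hne h1; apply: hne; rewrite eqEsubset; split=> // x hx.
by rewrite -(mulr1 x); apply: hM.
Qed.

Lemma prime_ideal1 A P : prime_ideal A P -> ~ P 1.
Proof. by case=> hI hne _; exact: ideal_proper1 hI hne. Qed.

Lemma prime_idealM A P x y : prime_ideal A P ->
  A x -> A y -> ~ P x -> ~ P y -> ~ P (x * y).
Proof. by case=> _ _ h hx hy nx ny /h []. Qed.

(** * Prime ideals that avoid the powers of an element *)

Lemma bigcup_chain2 (C : set (set F)) J x y :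
  total_on C subset -> (J `|` \bigcup_(X in C) X) x ->
  (J `|` \bigcup_(X in C) X) y ->
  (J x /\ J y) \/ exists X, [/\ C X, (J `|` X) x & (J `|` X) y].
Proof.
move=> tot [hx|[X hX hx]] [hy|[Y hY hy]].
- by left.
- by right; exists Y; split=> //; [left|right].
- by right; exists X; split=> //; [right|left].
- right; case: (tot X Y hX hY) => h.
  + by exists Y; split=> //; right=> //; apply: h.
  + by exists X; split=> //; right=> //; apply: h.
Qed.

(** An ideal [P] maximal among those that contain [J] and no power of [y] is prime: if [a] and [b]
    lie outside [P], then P + Aa and P + Ab both contain powers of [y], and [a * b] in [P] would put
    the product of these powers in [P]. The case [y = 1] gives a prime over any proper ideal. *)
Lemma exists_prime_avoiding A J y : is_subring A -> is_ideal A J -> A y ->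
  (forall m, ~ J (y ^+ m)) ->
  exists P, [/\ prime_ideal A P, J `<=` P & forall m, ~ P (y ^+ m)].
Proof.
move=> hA hJ hy hav.
(* Zorn is applied to the sets X such that J `|` X is a good ideal, because the
   empty chain has an empty union. *)
pose good X := is_ideal A (J `|` X) /\ forall m, ~ (J `|` X) (y ^+ m).
have [X [[hX hXav] hmax]] : exists X, good X /\ forall Y, X `<` Y -> ~ good Y.
  apply: Zorn_bigcup => C hC tot; have [J1 J2 J3 J4] := hJ; split.
    split.
    - by move=> x [/J1//|[X /hC[[h _ _ _] _] hx]]; apply: h; right.
    - by left.
    - move=> a b ha hb.
      case: (bigcup_chain2 tot ha hb) => [[ja jb]|[X [hX xa xb]]].
        by left; apply: J3.
      have [[_ _ h _] _] := hC _ hX; case: (h _ _ xa xb) => hh; [by left|].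
      by right; exists X.
    - move=> a x ha [hx|[X hX hx]]; first by left; apply: J4.
      have [[_ _ _ h] _] := hC _ hX.
      case: (h a x ha (or_intror hx)) => hh; [by left|].
      by right; exists X.
  move=> m [|[X hX hx]]; first exact: hav.
  by have [_ h] := hC _ hX; apply: (h m); right.
set P := J `|` X in hX hXav.
have maxP Q : is_ideal A Q -> P `<=` Q -> (exists2 x, Q x & ~ P x) ->
    exists m, Q (y ^+ m).
  move=> hQ hPQ [x Qx nPx]; apply: contrapT => hno; apply: (hmax Q).
    split; first by move=> z Xz; apply: hPQ; right.
    by move=> /(_ x Qx) Xx; apply: nPx; right.
  rewrite /good (_ : J `|` Q = Q); last first.
    by apply/seteqP; split=> z; [case=> // Jz; apply: hPQ; left|right].
  by split=> // m Qm; apply: hno; exists m.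
have [P1 P2 P3 P4] := hX.
exists P; split=> //; last by move=> z Jz; left.
split=> //.
  by move=> hPA; apply: (hXav 0%N); rewrite -/P hPA expr0; exact: subring1.
move=> a b Aa Ab Pab; apply: contrapT => /not_orP[nPa nPb].
pose Q c := [set p + r * c | p in P & r in A].
have idQ c : A c -> is_ideal A (Q c).
  move=> Ac; split.
  - move=> _ [p Pp [r Ar] <-].
    by apply: subringD => //; [exact: P1|exact: subringM].
  - by exists 0 => //; exists 0; [exact: subring0|rewrite mul0r addr0].
  - move=> _ _ [p Pp [r Ar] <-] [p' Pp' [r' Ar'] <-].
    exists (p + p'); first exact: P3.
    by exists (r + r'); [exact: subringD|ring].
  - move=> s _ As [p Pp [r Ar] <-].
    exists (s * p); first exact: P4.
    by exists (s * r); [exact: subringM|ring].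
have subQ c : P `<=` Q c.
  by move=> p Pp; exists p => //; exists 0; [exact: subring0|rewrite mul0r addr0].
have memQ c : Q c c.
  by exists 0 => //; exists 1; [exact: subring1|rewrite mul1r add0r].
have [m [p Pp [r Ar] Em]] : exists m, Q a (y ^+ m).
  by apply: maxP; [exact: idQ|exact: subQ|exists a].
have [n [p' Pp' [r' Ar'] En]] : exists n, Q b (y ^+ n).
  by apply: maxP; [exact: idQ|exact: subQ|exists b].
apply: (hXav (m + n)%N); rewrite exprD -Em -En -/P.
have -> : (p + r * a) * (p' + r' * b) =
  (p' + r' * b) * p + ((r * a) * p' + (r * r') * (a * b)) by ring.
apply: (P3); first by apply: P4 => //; apply: subringD => //; [exact: P1|exact: subringM].
by apply: (P3); apply: P4 => //; exact: subringM.
Qed.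

(* The elements of R outside the proper ideal M are the units of R. *)
Definition local_at (R M : set F) : Prop :=
  [/\ is_subring R, is_ideal R M, ~ M 1 &
      forall x, R x -> ~ M x -> x != 0 /\ R x^-1].

Lemma local_at_ring R M : local_at R M -> is_subring R.
Proof. by case. Qed.

Lemma local_at_unit R M x : local_at R M -> R x^-1 -> x != 0 -> ~ M x.
Proof.
by move=> [_ [_ _ _ h] h1 _] hx x0 Mx; apply: h1; rewrite -(mulVf x0); apply: h.
Qed.

Lemma local_atM R M x y : local_at R M ->
  R x -> R y -> ~ M x -> ~ M y -> ~ M (x * y).
Proof.
move=> h hx hy nx ny; have [hR _ _ hu] := h.
have [x0 xV] := hu _ hx nx; have [y0 yV] := hu _ hy ny.
apply: (local_at_unit h); first by rewrite invfM; apply: subringM.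
by rewrite mulf_neq0.
Qed.

(** * Localization at a prime ideal [P], with maximal ideal [locmax A P] *)

Definition locmax A P : set F := [set a / s | a in P & s in A `\` P].

Lemma prime_neq0 A P s : prime_ideal A P -> ~ P s -> s != 0.
Proof. by move=> [[_ h _ _] _ _] ns; apply/eqP => s0; apply: ns; rewrite s0. Qed.

Lemma sub_localization A P : is_subring A -> prime_ideal A P ->
  A `<=` localization A P.
Proof.
move=> hA hP a ha; exists a => //; exists 1; last by rewrite divr1.
by split; [exact: subring1|exact: prime_ideal1 hP].
Qed.

Lemma localizationV A P s : is_subring A -> A s -> ~ P s -> localization A P s^-1.
Proof.
by move=> hA hs ns; exists 1; [exact: subring1|exists s; rewrite ?div1r].
Qed.

Lemma localization_local A P : is_subring A -> prime_ideal A P ->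
  local_at (localization A P) (locmax A P).
Proof.
move=> hA hP; have [[P1 P2 P3 P4] hne hpr] := hP.
have n0 s : ~ P s -> s != 0 by apply: prime_neq0 hP.
have hM x y : A x -> A y -> ~ P x -> ~ P y -> (A `\` P) (x * y).
  by move=> *; split; [exact: subringM|exact: prime_idealM hP _ _ _ _].
split.
- apply/is_subringP; split.
  + by apply: sub_localization => //; apply: subring1.
  + move=> _ _ [a ha [s [hs ns] <-]] [b hb [t [ht nt] <-]].
    exists (a * t - b * s); first by apply: subringB => //; apply: subringM.
    by exists (s * t); [exact: hM|field; rewrite !n0].
  + move=> _ _ [a ha [s [hs ns] <-]] [b hb [t [ht nt] <-]].
    exists (a * b); first exact: subringM.
    by exists (s * t); [exact: hM|field; rewrite !n0].
- split.
  + by move=> _ [a ha [s hs <-]]; exists a; [exact: P1|exists s].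
  + exists 0 => //; exists 1; last by rewrite mul0r.
    by split; [exact: subring1|exact: prime_ideal1 hP].
  + move=> _ _ [a ha [s [hs ns] <-]] [b hb [t [ht nt] <-]].
    exists (t * a + s * b); first by apply: P3; apply: P4.
    by exists (s * t); [exact: hM|field; rewrite !n0].
  + move=> _ _ [a ha [s [hs ns] <-]] [b hb [t [ht nt] <-]].
    exists (a * b); first exact: P4.
    by exists (s * t); [exact: hM|field; rewrite !n0].
- by case=> a ha [s [hs ns] /divr1_eq E]; apply: ns; rewrite -E.
- move=> _ [a ha [s [hs ns] <-]] nM.
  have na : ~ P a by move=> Pa; apply: nM; exists a => //; exists s.
  split; first by rewrite mulf_neq0 ?invr_neq0 ?n0.
  by rewrite invf_div; exists s => //; exists a.
Qed.

Lemma locmaxE A P a : is_subring A -> prime_ideal A P ->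
  A a -> locmax A P a <-> P a.
Proof.
move=> hA hP ha; split=> [[b hb [s [hs ns] E]]|Pa].
  have [_ _ hpr] := hP; have [_ _ _ P4] := prime_ideal_ideal hP.
  apply: contrapT => na; apply: (prime_idealM hP hs ha ns na).
  by rewrite -E mulrC divfK ?(prime_neq0 hP ns).
exists a => //; exists 1; last by rewrite divr1.
by split; [exact: subring1|exact: prime_ideal1 hP].
Qed.

(** The prime of [B] is the contraction of the maximal ideal of A_P. The multipliers [s] are units
    of A_P, so they move numerators and denominators from [A] into [B] without changing the ring of
    fractions. This identifies the localizations shared by two charts. *)
Lemma localization_transfer A B P : is_subring A -> is_subring B ->
  prime_ideal A P -> B `<=` localization A P ->
  (forall a, A a -> exists s, [/\ B s, A s^-1, s != 0 & B (s * a)]) ->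
  loc_set B (localization A P).
Proof.
move=> hA hB hP hBA hAB.
have hloc := localization_local hA hP; have [hR hMi hM1 hu] := hloc.
set R := localization A P in hBA hR hMi hM1 hu hloc *.
set M := locmax A P in hMi hM1 hu hloc *.
have [M1 M2 M3 M4] := hMi.
have hAR : A `<=` R by apply: sub_localization.
exists (B `&` M).
  split.
  - split.
    + by move=> x [].
    + by split=> //; apply: subring0.
    + by move=> x y [hx Mx] [hy My]; split; [exact: subringD|exact: M3].
    + by move=> x y hx [hy My]; split; [exact: subringM|apply: M4=> //; exact: hBA].
  - by move=> E; apply: hM1; have := subring1 hB; rewrite -E => -[].
  - move=> x y hx hy [_ Mxy]; apply: contrapT => /not_orP[nx ny].
    have nMx : ~ M x by move=> ?; apply: nx.
    have nMy : ~ M y by move=> ?; apply: ny.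
    exact: (local_atM hloc (hBA _ hx) (hBA _ hy) nMx nMy Mxy).
apply/seteqP; split.
- move=> _ [b hb [c [hc nc] <-]]; apply: subringM => //; first exact: hBA.
  have nMc : ~ M c by move=> ?; apply: nc.
  by case: (hu _ (hBA _ hc) nMc).
- move=> _ [a ha [s [hs ns] <-]].
  have [c [Bc Ac c0 Bca]] := hAB _ ha; have [d [Bd Ad d0 Bds]] := hAB _ hs.
  (* With [c] and [d] units of [R], the fraction a / s equals d c a / (c d s), whose two terms lie
     in [B]. *)
  exists (d * (c * a)); first exact: subringM.
  exists (c * (d * s)); last by field; rewrite c0 d0 (prime_neq0 hP).
  split; first exact: subringM.
  have nMs : ~ M s by move=> /(locmaxE hA hP hs).
  have unitM e : B e -> A e^-1 -> e != 0 -> ~ M e.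
    by move=> Be Ae; apply: local_at_unit hloc _; exact: hAR.
  case=> _; apply: (local_atM hloc); [exact: hBA|exact: hBA|exact: unitM|].
  by apply: (local_atM hloc); [exact: hBA|exact: hAR|exact: unitM|].
Qed.

(** For a subring [A] containing a nonzero [u] this is A[1/u]. Any subset [A] is allowed, so that
    the notion also covers ideals and meets of preideals. *)
Definition saturation A u : set F := [set a | exists m, A (u ^+ m * a)].

Lemma saturation_ge A u a m m' : (forall x, A x -> A (u * x)) ->
  A (u ^+ m * a) -> (m <= m')%N -> A (u ^+ m' * a).
Proof.
move=> hu ha /subnK<-; elim: (m' - m)%N => [|n ih]; first by rewrite add0n.
by rewrite addSn exprS -mulrA; apply: hu.
Qed.

Lemma sub_saturation A u : A `<=` saturation A u.
Proof. by move=> a ha; exists 0%N; rewrite mul1r. Qed.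

Lemma saturation_subring A u : is_subring A -> A u -> is_subring (saturation A u).
Proof.
move=> hA hu; have hge := @saturation_ge A u.
have huM x : A x -> A (u * x) by exact: subringM.
apply/is_subringP; split.
- by apply: sub_saturation; exact: subring1.
- move=> a b [m ha] [n hb]; exists (m + n)%N; rewrite mulrBr.
  by apply: subringB => //; [exact: hge ha (leq_addr _ _)|exact: hge hb (leq_addl _ _)].
- move=> a b [m ha] [n hb]; exists (m + n)%N; rewrite exprD mulrACA.
  exact: subringM.
Qed.

End Subrings.

(** * Polynomials with coefficients in an ideal, and McCoy's theorem *)

Section Nagata.
Variable K : fieldType.
Implicit Types A I M P R : set K.
Implicit Types p q g : {poly K}.
Local Notation E := (ratfrac K).
Implicit Types J N S : set E.

Lemma polys_coef I p : I 0 -> polys I p <-> forall k, I p`_k.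
Proof.
move=> I0; split=> [/(all_nthP 0) h k|h].
  by case: (ltnP k (size p)) => [/h /set_mem //|/(nth_default 0) ->].
by apply/(all_nthP 0) => k _; apply: mem_set.
Qed.

Definition coefs_in I p := forall k, I p`_k.

Lemma coefs_inD A I p q : is_ideal A I -> coefs_in I p -> coefs_in I q ->
  coefs_in I (p + q).
Proof. by move=> [_ _ h _] hp hq k; rewrite coefD; apply: h. Qed.

Lemma ideal_sum A I n (f : 'I_n -> K) : is_ideal A I -> (forall i, I (f i)) ->
  I (\sum_i f i).
Proof. by move=> [_ h0 hD _] h; elim/big_ind: _. Qed.

Lemma coefs_inM A I p q : is_ideal A I -> coefs_in A p -> coefs_in I q ->
  coefs_in I (p * q).
Proof.
move=> hI hp hq k; rewrite coefM; apply: (ideal_sum hI) => i.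
by have [_ _ _] := hI; apply.
Qed.

Lemma coefs_in_ringM A p q : is_subring A -> coefs_in A p -> coefs_in A q ->
  coefs_in A (p * q).
Proof. by move=> hA; apply: coefs_inM; apply: is_ideal_refl. Qed.

Lemma coefs_inZ A c p : is_subring A -> A c -> coefs_in A p -> coefs_in A (c *: p).
Proof. by move=> hA hc hp k; rewrite coefZ; apply: subringM. Qed.

Lemma coefs_inC I c : I 0 -> I c -> coefs_in I c%:P.
Proof. by move=> h0 hc [|k]; rewrite coefC. Qed.

Lemma coefs_inXn A n : is_subring A -> coefs_in A 'X^n.
Proof.
move=> hA k; rewrite coefXn; case: eqP => _; [exact: subring1|exact: subring0].
Qed.

Lemma coefs_in_ringD A p q : is_subring A -> coefs_in A p -> coefs_in A q ->
  coefs_in A (p + q).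
Proof. by move=> hA; apply: coefs_inD; apply: is_ideal_refl. Qed.

(* McCoy's argument: in (R/I)[t], a polynomial g with a unit coefficient is not
   a zero divisor. *)
Lemma coefs_in_cancel R I p g k : is_subring R -> is_ideal R I ->
  coefs_in R p -> coefs_in R g -> g`_k != 0 -> R (g`_k)^-1 ->
  coefs_in I (p * g) -> coefs_in I p.
Proof.
move=> hR hI hp hg gk0 gkV; have [I1 I2 I3 I4] := hI.
have [n] := ubnP (size p); elim: n => // n IH in p hp *.
rewrite ltnS => hsz hpg.
pose d := (size p).-1.
have hd i : (d < i)%N -> (size p <= i)%N by rewrite /d; case: (size p).
pose cut m := \poly_(j < m) g`_j.
have top m : forall l, (m <= l)%N -> coefs_in I (g`_l *: p).
  have [r] := ubnP (size g - m); elim: r => // r IHr in m * => hr l.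
  rewrite leq_eqVlt => /orP[/eqP<-|hl]; last first.
    have [hgl|hgl] := leqP (size g) m; last first.
      by apply: (IHr m.+1) => //; move: hgl hr; clear; lia.
    move=> j; rewrite coefZ nth_default ?mul0r //.
    exact: leq_trans hgl (ltnW hl).
  have [hgm|hgm] := leqP (size g) m.
    by move=> j; rewrite coefZ nth_default ?mul0r.
  (* Modulo [I], the coefficients of [g] above [m] kill [p], so [g] may be truncated; the top
     coefficient of the truncated product is then [g]_m * p[_d]. *)
  have hcut : coefs_in I (p * cut m.+1).
    have -> : p * cut m.+1 = p * g - p * (g - cut m.+1) by ring.
    move=> j; rewrite coefB; apply: I3 => //; apply: (idealN hR hI).
    rewrite coefM; apply: (ideal_sum hI) => i.
    rewrite coefB coef_poly; case: ltnP => hl.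
      by rewrite subrr mulr0.
    have lt_r : (size g - m.+1 < r)%N by move: hgm hr; clear; lia.
    by rewrite subr0 mulrC -coefZ; apply: (IHr m.+1).
  have htop : I (g`_m * p`_d).
    have := hcut (d + m)%N; rewrite coefM.
    have dm : (d < (d + m).+1)%N by lia.
    rewrite (bigD1 (Ordinal dm)) //= big1 => [|i /eqP hi]; last first.
      have [di|di] := ltnP d i.
        by rewrite nth_default ?mul0r // hd.
      rewrite coef_poly; case: ltnP; rewrite ?mulr0 // => h.
      case: hi; apply: val_inj => /=; lia.
    by rewrite coef_poly addKn ltnSn addr0 mulrC.
  have htopI : coefs_in I ((g`_m * p`_d) *: 'X^d).
    move=> j; rewrite coefZ coefXn mulrC; apply: I4 => //.
    by case: eqP => _; [exact: subring1|exact: subring0].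
  (* Removing the top term, which lies in [I], lowers the degree, and the outer induction applies to
     [p']. *)
  set p' := g`_m *: p - (g`_m * p`_d) *: 'X^d.
  have p'E : g`_m *: p = p' + (g`_m * p`_d) *: 'X^d by rewrite subrK.
  rewrite p'E; apply: (coefs_inD hI) => //.
  have [p0|pn0] := eqVneq p 0.
    by move=> j; rewrite /p' p0 scaler0 coef0 mulr0 scale0r subrr coef0.
  apply: IH.
  - move=> j; rewrite coefB coefZ; apply: subringB => //; first exact: subringM.
    by apply: I1.
  - have : (size p' <= d)%N.
      apply/leq_sizeP => j dj; rewrite coefB !coefZ coefXn.
      have [->|jd] := eqVneq j d; first by rewrite mulr1 subrr.
      have pj : (size p <= j)%N by apply: hd; rewrite ltn_neqAle eq_sym jd.
      by rewrite mulr0 subr0 (nth_default 0 pj) mulr0.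
    by move=> h; apply: leq_ltn_trans h _; rewrite prednK // size_poly_gt0.
  - have h1 : coefs_in I (g`_m *: (p * g)).
      by move=> j; rewrite coefZ; apply: I4.
    have h2 : coefs_in I (g * ((g`_m * p`_d) *: 'X^d)) by exact: coefs_inM hI hg htopI.
    rewrite /p' mulrBl -scalerAl [X in _ - X]mulrC => j.
    by rewrite coefB; apply: I3 => //; apply: (idealN hR hI).
move=> j; have := top 0%N k isT j; rewrite coefZ => h.
by rewrite -[p`_j](mulKf gk0); apply: I4.
Qed.

(** * Primitive polynomials and the Nagata extension of a local ring *)

Definition has_unit_coef M q := exists k, ~ M q`_k.

(** If all coefficients lie in [M], so does the ideal they generate, and it misses 1; conversely a
    coefficient outside [M] is a unit. *)
Lemma primitiveP R M q : local_at R M ->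
  primitive_polys R q <-> coefs_in R q /\ has_unit_coef M q.
Proof.
move=> hloc; have [hR hM hM1 hu] := hloc; rewrite /primitive_polys /=.
have R0 := subring0 hR.
split=> [[/(polys_coef _ R0) hq hgen]|[hq [k nk]]].
  split=> //; apply: contrapT => hno; apply: hM1.
  have : R 1 by exact: subring1.
  rewrite -hgen; apply: smallest_sub => // c /= /(nthP 0)[k _ <-].
  by apply: contrapT => nM; apply: hno; exists k.
split; first exact/(polys_coef _ R0).
apply/seteqP; split.
  apply: smallest_sub; first exact: is_ideal_refl.
  by move=> c /= /(nthP 0)[j _ <-].
move=> x hx I [[_ _ _ I4] hqI].
have [q0 qV] := hu _ (hq k) nk.
rewrite -(divfK q0 x); apply: I4; first exact: subringM.
apply: hqI; rewrite /= mem_nth //.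
by case: ltnP => // h; move: q0; rewrite nth_default ?eqxx.
Qed.

Lemma has_unit_coef_neq0 R M q : local_at R M -> has_unit_coef M q -> q != 0.
Proof.
by move=> [_ [_ h _ _] _ _] [k nk]; apply/eqP => q0; apply: nk; rewrite q0 coef0.
Qed.

Lemma coefs_in_cancel_local R M I p q : local_at R M -> is_ideal R I ->
  coefs_in R p -> coefs_in R q -> has_unit_coef M q ->
  coefs_in I (p * q) -> coefs_in I p.
Proof.
move=> [hR _ _ hu] hI hp hq [k nk]; have [q0 qV] := hu _ (hq k) nk.
exact: coefs_in_cancel hR hI hp hq q0 qV.
Qed.

(** Gauss's lemma: if [p * q] had all its coefficients in [M], cancelling [q] modulo [M] would leave
    those of [p] in [M]. *)
Lemma has_unit_coefM R M p q : local_at R M -> coefs_in R p -> coefs_in R q ->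
  has_unit_coef M p -> has_unit_coef M q -> has_unit_coef M (p * q).
Proof.
move=> hloc hp hq [k nk] hq'; apply: contrapT => hno; apply: nk.
have [_ hM _ _] := hloc; apply: (coefs_in_cancel_local hloc hM hp hq hq') => j.
by apply: contrapT => nj; apply: hno; exists j.
Qed.

Lemma has_unit_coef1 R M : local_at R M -> has_unit_coef M 1.
Proof. by case=> _ _ h1 _; exists 0%N; rewrite coef1. Qed.

(** Explicit form of the extension I R(t); taking [I = R] gives R(t) itself. *)
Definition ext_nagata R M I : set E := [set z | exists p q,
  [/\ coefs_in I p, coefs_in R q, has_unit_coef M q & z = tofrac p / tofrac q]].

Lemma nagataE R M : local_at R M -> nagata R = ext_nagata R M R.
Proof.
move=> hloc; have R0 := subring0 (local_at_ring hloc).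
apply/seteqP; split.
  move=> _ [p /(polys_coef _ R0) hp [q /(primitiveP _ hloc)[hq hq'] <-]].
  by exists p, q.
move=> _ [p [q [hp hq hq' ->]]]; exists p; first exact/(polys_coef _ R0).
by exists q => //; apply/(primitiveP _ hloc).
Qed.

Section Local.
Variables (R M : set K).
Hypothesis hloc : local_at R M.
Let hR := local_at_ring hloc.

Lemma ext_nagataD I x y : is_ideal R I ->
  ext_nagata R M I x -> ext_nagata R M I y -> ext_nagata R M I (x + y).
Proof.
move=> hI [p [q [hp hq uq ->]]] [p' [q' [hp' hq' uq' ->]]].
exists (p * q' + p' * q), (q * q'); split.
- by apply: (coefs_inD hI); rewrite mulrC; apply: (coefs_inM hI).
- exact: coefs_in_ringM.
- exact: has_unit_coefM hloc hq hq' uq uq'.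
rewrite tofracD !tofracM addf_div // tofrac_eq0.
  exact: has_unit_coef_neq0 hloc uq.
exact: has_unit_coef_neq0 hloc uq'.
Qed.

Lemma ext_nagataM I x y : is_ideal R I ->
  nagata R x -> ext_nagata R M I y -> ext_nagata R M I (x * y).
Proof.
rewrite (nagataE hloc).
move=> hI [p [q [hp hq uq ->]]] [p' [q' [hp' hq' uq' ->]]].
exists (p * p'), (q * q'); split.
- exact: (coefs_inM hI).
- exact: coefs_in_ringM.
- exact: has_unit_coefM hloc hq hq' uq uq'.
by rewrite !tofracM mulf_div.
Qed.

Lemma ext_nagata_poly I p : coefs_in I p -> ext_nagata R M I (tofrac p).
Proof.
move=> hp; exists p, 1; split=> //; last by rewrite tofrac1 divr1.
- by apply: coefs_inC; [exact: subring0|exact: subring1].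
- exact: has_unit_coef1 hloc.
Qed.

Lemma nagata_poly p : coefs_in R p -> nagata R (tofrac p).
Proof. by rewrite (nagataE hloc); exact: ext_nagata_poly. Qed.

Lemma nagataC c : R c -> nagata R (ratC c).
Proof. by move=> hc; apply: nagata_poly; apply: coefs_inC => //; exact: subring0. Qed.

Lemma nagata_polyV p : coefs_in R p -> has_unit_coef M p -> nagata R (tofrac p)^-1.
Proof.
move=> hp up; rewrite (nagataE hloc); exists 1, p; split=> //.
  by apply: coefs_inC; [exact: subring0|exact: subring1].
by rewrite tofrac1 div1r.
Qed.

Lemma nagata_subring : is_subring (nagata R).
Proof.
have hRR := is_ideal_refl hR.
have hM x y : nagata R x -> nagata R y -> nagata R (x * y).
  by move=> hx; rewrite {1 2}(nagataE hloc); exact: ext_nagataM.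
apply/is_subringP; split=> //.
  by rewrite -tofrac1; apply: nagata_poly; apply: coefs_inC; [exact: subring0|exact: subring1].
move=> x y hx hy; have : nagata R (-1 * y).
  apply: hM => //; rewrite -tofrac1 -tofracN; apply: nagata_poly.
  rewrite -polyC1 -polyCN; apply: coefs_inC; first exact: subring0.
  by apply: subringN => //; exact: subring1.
rewrite mulN1r; move: hx; rewrite !(nagataE hloc); exact: ext_nagataD.
Qed.

Lemma ext_nagata_ideal I : is_ideal R I -> is_ideal (nagata R) (ext_nagata R M I).
Proof.
move=> hI; have [I1 I2 _ _] := hI; split.
- move=> _ [p [q [hp hq uq ->]]]; rewrite (nagataE hloc); exists p, q; split=> // k.
  exact: I1.
- by rewrite -tofrac0; apply: ext_nagata_poly => k; rewrite coef0.
- by move=> x y; exact: ext_nagataD.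
- by move=> a x; exact: ext_nagataM.
Qed.

Lemma sub_ratC_nagata I : is_ideal R I -> @ratC K @` I `<=` nagata R.
Proof. by move=> [I1 _ _ _] _ [c hc <-]; apply: nagataC; apply: I1. Qed.

Lemma ideal_gen_ratC I : is_ideal R I ->
  ideal_gen (nagata R) (@ratC K @` I) = ext_nagata R M I.
Proof.
move=> hI; have [I1 I2 _ _] := hI; apply/seteqP; split.
  apply: smallest_sub; first exact: ext_nagata_ideal.
  by move=> _ [c hc <-]; apply: ext_nagata_poly; exact: coefs_inC.
have [J1 J2 J3 J4] := is_ideal_gen nagata_subring (sub_ratC_nagata hI).
move=> _ [p [q [hp hq uq ->]]]; rewrite mulrC; apply: (J4); first exact: nagata_polyV.
rewrite -[p]coefK poly_def raddf_sum /=.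
elim/big_ind: _ => // i _; rewrite -mul_polyC mulrC tofracM; apply: J4.
  by apply: nagata_poly; exact: coefs_inXn.
by apply: sub_gen_smallest; exists p`_i.
Qed.

(** From p = p' / q one gets p q = p' in I[t], and McCoy's theorem cancels the primitive [q]. Thus I
    R(t) meets R[t] in I[t], and meets [R] in [I]. *)
Lemma ext_nagata_coefs I p : is_ideal R I -> coefs_in R p ->
  ext_nagata R M I (tofrac p) -> coefs_in I p.
Proof.
move=> hI hp [p' [q [hp' hq uq E]]].
apply: (coefs_in_cancel_local hloc hI hp hq uq).
have q0 := has_unit_coef_neq0 hloc uq.
suff -> : p * q = p' by [].
by apply/eqP; rewrite -tofrac_eq tofracM E divfK // tofrac_eq0.
Qed.

Lemma ext_nagata_ratC I c : is_ideal R I -> R c ->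
  ext_nagata R M I (ratC c) -> I c.
Proof.
move=> hI hc /ext_nagata_coefs -/(_ hI) h.
by have := h (coefs_inC (subring0 hR) hc) 0%N; rewrite coefC.
Qed.

End Local.

(** * Polynomial denominators over a ring [A], relative to an A[t]-submodule of K(t) *)

Definition poly_submod A N : Prop :=
  [/\ N 0, (forall x y, N x -> N y -> N (x + y)) &
      forall p x, coefs_in A p -> N x -> N (tofrac p * x)].

Lemma clear_denominators A P p : is_subring A -> prime_ideal A P ->
  coefs_in (localization A P) p ->
  exists s, [/\ A s, ~ P s & coefs_in A (s *: p)].
Proof.
move=> hA hP hp; have A1 := subring1 hA; have A0 := subring0 hA.
suff [s [hs ns h]] : exists s, [/\ A s, ~ P s &
    forall k, (k < size p)%N -> A (s * p`_k)].
  exists s; split=> // k; rewrite coefZ; case: (ltnP k (size p)) => [/h //|kp].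
  by rewrite nth_default ?mulr0.
elim: (size p) => [|n [s [hs ns h]]].
  by exists 1; split=> //; exact: prime_ideal1 hP.
have [a ha [t [ht nt] E]] := hp n.
exists (t * s); split; [exact: subringM|exact: prime_idealM hP _ _ _ _|].
move=> k; rewrite ltnS leq_eqVlt => /orP[/eqP->|/h hk].
  rewrite -E -[X in A X](_ : s * a = _); first exact: subringM.
  by field; exact: prime_neq0 hP nt.
by rewrite -mulrA; apply: subringM.
Qed.

(** The elements of R(t), for R = A_P, that some polynomial over [A], primitive over [R], multiplies
    into [N] form an ideal of R(t) that contains [J]. *)
Lemma ideal_gen_nagata_denominator A P N J z :
  is_subring A -> prime_ideal A P -> poly_submod A N -> J `<=` N ->
  J `<=` nagata (localization A P) ->
  ideal_gen (nagata (localization A P)) J z ->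
  exists q, [/\ coefs_in A q, has_unit_coef P q & N (tofrac q * z)].
Proof.
move=> hA hP [N0 ND NM] hJN hJR.
have hloc := localization_local hA hP; have hR := local_at_ring hloc.
have hS := nagata_subring hloc.
set R := localization A P in hJR hloc hR hS *.
set M := locmax A P in hloc.
have hAR q : coefs_in A q -> coefs_in R q.
  by move=> h k; apply: sub_localization.
(* For polynomials over [A] the two conditions agree, because the maximal ideal of A_P contracts to
   [P]. *)
have hMP q : coefs_in A q -> has_unit_coef M q -> has_unit_coef P q.
  by move=> h [k nk]; exists k => Pk; apply: nk; apply/locmaxE.
suff : ideal_gen (nagata R) J `<=` [set z | nagata R z /\
    exists q, [/\ coefs_in A q, has_unit_coef M q & N (tofrac q * z)]].
  by move=> h /h[_ [q [h1 h2 h3]]]; exists q; split=> //; exact: hMP.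
have A1 : coefs_in A 1 by apply: coefs_inC; [exact: subring0|exact: subring1].
apply: smallest_sub; last first.
  move=> w Jw; split; first exact: hJR.
  exists 1; split=> //; first exact: has_unit_coef1 hloc.
  by rewrite tofrac1 mul1r; apply: hJN.
split.
- by move=> w [].
- split; first exact: subring0.
  exists 1; split=> //; first exact: has_unit_coef1 hloc.
  by rewrite mulr0.
- move=> x y [hx [q [hq uq Nq]]] [hy [q' [hq' uq' Nq']]].
  split; first exact: subringD.
  exists (q * q'); split.
  + exact: coefs_in_ringM.
  + by apply: (has_unit_coefM hloc) => //; exact: hAR.
  + rewrite tofracM (_ : _ * _ * _ =
      tofrac q' * (tofrac q * x) + tofrac q * (tofrac q' * y)).
      by apply: ND; apply: NM.
    by rewrite mulrDr; congr (_ + _); rewrite ?mulrA // [tofrac q' * _]mulrC.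
- move=> a x ha [hx [q [hq uq Nq]]]; split; first exact: subringM.
  move: ha; rewrite (nagataE hloc) => -[p [g [hp hg ug ->]]].
  (* The common denominator [s * t] brings [p] and [g] into A[t]; being a unit of [R], it keeps [g]
     primitive. *)
  have [s [As ns sp]] := clear_denominators hA hP hp.
  have [t [At nt tg]] := clear_denominators hA hP hg.
  have stg : coefs_in A ((s * t) *: g) by rewrite -scalerA; exact: coefs_inZ.
  have stp : coefs_in A ((s * t) *: p) by rewrite mulrC -scalerA; exact: coefs_inZ.
  exists (((s * t) *: g) * q); split; first exact: coefs_in_ringM.
    apply: (has_unit_coefM hloc) => //; try exact: hAR.
    have [k nk] := ug; exists k; rewrite coefZ; apply: (local_atM hloc) => //.
      by apply: sub_localization => //; exact: subringM.
    by move=> /(locmaxE hA hP (subringM hA As At)); apply: prime_idealM hP _ _ _ _.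
  rewrite (_ : _ * _ = tofrac ((s * t) *: p) * (tofrac q * x)); first exact: NM.
  have g0 : tofrac g != 0 by rewrite tofrac_eq0; exact: has_unit_coef_neq0 hloc ug.
  by rewrite -!mul_polyC !tofracM mulr_cancel_denom.
Qed.

(** The coefficients of all [q] in A[t] with q z in [N] form an ideal [C]. At each prime [P] the
    local denominator has a coefficient outside [P], so no prime contains [C], and 1 lies in [C]. *)
Lemma exists_monic_coef_denominator A N J z :
  is_subring A -> poly_submod A N -> J `<=` N ->
  (forall R, loc_set A R -> J `<=` nagata R) ->
  (forall R, loc_set A R -> ideal_gen (nagata R) J z) ->
  exists q, [/\ coefs_in A q, (exists k, q`_k = 1) & N (tofrac q * z)].
Proof.
move=> hA hN hJN hJR hz; have [N0 ND NM] := hN.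
pose C := [set c | exists q k, [/\ coefs_in A q, N (tofrac q * z) & q`_k = c]].
have hC : is_ideal A C.
  split.
  - by move=> _ [q [k [hq _ <-]]]; exact: hq.
  - exists 0, 0%N; split; last by rewrite coef0.
      by move=> k; rewrite coef0; exact: subring0.
    by rewrite tofrac0 mul0r.
  - move=> _ _ [q [k [hq Nq <-]]] [q' [k' [hq' Nq' <-]]].
    (* The shifts bring coefficient [k] of [q] and coefficient [k'] of [q'] to the same index. *)
    exists ('X^k' * q + 'X^k * q'), (k + k')%N; split.
    + by apply: coefs_in_ringD => //; apply: coefs_in_ringM => //; exact: coefs_inXn.
    + rewrite tofracD !tofracM mulrDl -!mulrA.
      by apply: ND; apply: NM => //; exact: coefs_inXn.
    + by rewrite coefD !coefXnM addnK addKn !ifN // -leqNgt ?leq_addr ?leq_addl.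
  - move=> a _ ha [q [k [hq Nq <-]]]; exists (a%:P * q), k; split.
    + by rewrite mul_polyC; exact: coefs_inZ.
    + by rewrite tofracM -mulrA; apply: NM => //; apply: coefs_inC => //; exact: subring0.
    + by rewrite coefCM.
have [[q [k [hq Nq qk]]]|nC1] := pselect (C 1); first by exists q; split=> //; exists k.
have [|P [hP CP _]] := exists_prime_avoiding hA hC (subring1 hA).
  by move=> m; rewrite expr1n.
have hR : loc_set A (localization A P) by exists P.
have [q [hq [k nk] Nq]] :=
  ideal_gen_nagata_denominator hA hP hN hJN (hJR _ hR) (hz _ hR).
by case: nk; apply: CP; exists q, k.
Qed.

(** * Constants in K(t), and exponents that serve finitely many conditions at once *)

Lemma subring_tofrac S A p : is_subring S -> S (tofrac 'X) ->
  @ratC K @` A `<=` S -> coefs_in A p -> S (tofrac p).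
Proof.
move=> hS hX hA hp; rewrite -[p]coefK poly_def raddf_sum /=.
elim/big_ind: _ => [|x y|i _]; [exact: subring0|exact: subringD|].
rewrite -mul_polyC tofracM tofracXn; apply: subringM => //; last exact: subringX.
by apply: hA; exists p`_i.
Qed.

Lemma preimage_ratC_subring S : is_subring S -> is_subring (@ratC K @^-1` S).
Proof.
move=> hS; apply/is_subringP; rewrite /ratC; split=> /=.
- by rewrite polyC1 tofrac1; exact: subring1.
- by move=> x y hx hy; rewrite polyCB tofracB; exact: subringB.
- by move=> x y hx hy; rewrite polyCM tofracM; exact: subringM.
Qed.

Lemma ratCM : {morph @ratC K : x y / x * y}.
Proof. by move=> x y; rewrite /ratC polyCM tofracM. Qed.

Lemma ratCX n : {morph @ratC K : x / x ^+ n}.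
Proof. by move=> x; rewrite /ratC rmorphXn /= tofracXn. Qed.

Definition eventually (Q : nat -> Prop) :=
  exists m0, forall m, (m0 <= m)%N -> Q m.

Lemma eventually_all (T : eqType) (s : seq T) (Q : T -> nat -> Prop) :
  (forall x, x \in s -> eventually (Q x)) ->
  eventually (fun m => forall x, x \in s -> Q x m).
Proof.
elim: s => [_|x s IH h]; first by exists 0%N.
have [m hm] : eventually (fun m => forall x, x \in s -> Q x m).
  by apply: IH => y ys; apply: h; rewrite inE ys orbT.
have [n hn] := h x (mem_head _ _).
exists (maxn m n) => k; rewrite geq_max => /andP[mk nk] y.
by rewrite inE => /orP[/eqP->|]; [exact: hn|exact: hm].
Qed.

Lemma eventually_exists (T : Type) (Q : T -> nat -> Prop) t :
  eventually (Q t) -> eventually (fun m => exists t, Q t m).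
Proof. by move=> [m hm]; exists m => n mn; exists t; exact: hm. Qed.

(** * The charts of a projective model and the ring [Dstar] *)

Section Model.
Variables (D : set K) (s : seq K).
Hypothesis hs : exists2 x, x \in s & x != 0.
Local Notation H := [set` s].
Let X := blowup_set D H.
Let chart x := adjoin D [set y / x | y in H].
Let f : {poly K} := Poly s.
Let u x : E := ratC x / tofrac f.
Let Dstar := nagata_meet X.

Lemma chart_subring x : is_subring (chart x).
Proof. exact: subring_adjoin. Qed.
Hint Resolve chart_subring : core.

Lemma chart_mem x y : y \in s -> chart x (y / x).
Proof. by move=> hy; apply: sub_adjoin; right; exists y. Qed.

Lemma chart_sub x (B : set K) : is_subring B -> D `<=` B ->
  (forall y, y \in s -> B (y / x)) -> chart x `<=` B.
Proof.
move=> hB hDB h; apply: smallest_sub => // z [/hDB //|[y ys <-]]; exact: h.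
Qed.

Lemma blowup_chart x : x \in s -> x != 0 -> loc_set (chart x) `<=` X.
Proof. by move=> xs x0 R hR; exists x => //; split=> //; apply/eqP. Qed.

Lemma blowupP R : X R -> exists x, [/\ x \in s, x != 0 & loc_set (chart x) R].
Proof. by move=> [x [xs /eqP x0] hR]; exists x. Qed.

Lemma loc_set_local A R : is_subring A -> loc_set A R ->
  A `<=` R /\ exists M, local_at R M.
Proof.
move=> hA [P hP <-]; split; first exact: sub_localization.
by exists (locmax A P); exact: localization_local.
Qed.

Lemma blowup_local R : X R -> exists M, local_at R M.
Proof. by move=> /blowupP[x [_ _ /loc_set_local[]]]. Qed.

Lemma f_neq0 : f != 0.
Proof.
have [x xs x0] := hs; apply/eqP => f0; move: x0; rewrite -(nth_index 0 xs).
by rewrite -coef_Poly -/f f0 coef0 eqxx.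
Qed.

Lemma f_chart x : x \in s -> coefs_in (chart x) (x^-1 *: f).
Proof.
move=> xs k; rewrite coefZ coef_Poly mulrC.
have [ks|ks] := ltnP k (size s); first by apply: chart_mem; exact: mem_nth.
by rewrite nth_default // mul0r; exact: subring0.
Qed.

Lemma f_chart1 x : x \in s -> x != 0 -> (x^-1 *: f)`_(index x s) = 1.
Proof. by move=> xs x0; rewrite coefZ coef_Poly nth_index // mulVf. Qed.

Lemma tofrac_f_neq0 : tofrac f != 0.
Proof. by rewrite tofrac_eq0 f_neq0. Qed.

Lemma ratC_neq0 (c : K) : c != 0 -> ratC c != 0.
Proof. by rewrite tofrac_eq0 polyC_eq0. Qed.

Lemma ratCV (c : K) : ratC c^-1 = (ratC c)^-1.
Proof.
have [->|c0] := eqVneq c 0; first by rewrite invr0 /ratC tofrac0 invr0.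
by apply: (mulfI (ratC_neq0 c0)); rewrite -ratCM !divff ?ratC_neq0.
Qed.

Lemma tofracZ (c : K) p : tofrac (c *: p) = ratC c * tofrac p.
Proof. by rewrite -mul_polyC tofracM. Qed.

(** The form of x / f suited to the chart of [w]: for [x] and [w] in [s] the numerator lies in the
    chart ring and the denominator is primitive. *)
Lemma u_chart x w : w != 0 -> u x = ratC (x / w) / tofrac (w^-1 *: f).
Proof.
move=> w0; rewrite tofracZ ratCM invfM -ratCV invrK mulrACA ratCV.
by rewrite mulrA mulfK ?ratC_neq0.
Qed.

Lemma chart_scaled_f R w : w \in s -> w != 0 -> loc_set (chart w) R ->
  [/\ coefs_in R (w^-1 *: f), nagata R (tofrac (w^-1 *: f)) &
      nagata R (tofrac (w^-1 *: f))^-1].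
Proof.
move=> ws w0 hR; have [hAR [M hloc]] := loc_set_local (chart_subring w) hR.
have hf : coefs_in R (w^-1 *: f) by move=> k; apply: hAR; exact: f_chart.
split=> //; first exact: (nagata_poly hloc).
apply: (nagata_polyV hloc) => //; exists (index w s); rewrite f_chart1 //.
by case: hloc.
Qed.

Lemma Dstar_subring : is_subring Dstar.
Proof.
apply: bigcap_subring => R XR; have [M hloc] := blowup_local XR.
exact: nagata_subring hloc.
Qed.
Hint Resolve Dstar_subring : core.

Lemma Dstar_sub_nagata R : X R -> Dstar `<=` nagata R.
Proof. by move=> XR z; apply. Qed.

Lemma Dstar_poly p : coefs_in D p -> Dstar (tofrac p).
Proof.
move=> hp R XR; have [x [xs x0 hR]] := blowupP XR.
have [hAR [M hloc]] := loc_set_local (chart_subring x) hR.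
by apply: (nagata_poly hloc) => k; apply: hAR; apply: sub_adjoin; left.
Qed.

Hypothesis hD : is_subring D.

Lemma Dstar_Xn n : Dstar (tofrac 'X^n).
Proof. by apply: Dstar_poly; exact: coefs_inXn. Qed.

Lemma Dstar_u x : x \in s -> Dstar (u x).
Proof.
move=> xs R XR; have [w [ws w0 hR]] := blowupP XR.
have [hAR [M hloc]] := loc_set_local (chart_subring w) hR.
have [_ _ hf] := chart_scaled_f ws w0 hR.
rewrite (u_chart _ w0); apply: subringM; [exact: nagata_subring hloc| |exact: hf].
by apply: (nagataC hloc); apply: hAR; exact: chart_mem.
Qed.

(** It suffices to treat the generators y / x, for which (x / w) (y / x) = y / w. *)
Lemma chart_absorb x w a : x \in s -> x != 0 -> w \in s -> w != 0 ->
  chart x a -> saturation (chart w) (x / w) a.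
Proof.
move=> xs x0 ws w0; apply: chart_sub.
- by apply: saturation_subring => //; exact: chart_mem.
- by move=> d Dd; apply: sub_saturation; apply: sub_adjoin; left.
- move=> y ys; exists 1%N; rewrite expr1 (_ : _ * _ = y / w); first exact: chart_mem.
  by field; rewrite w0 x0.
Qed.

(** The indeterminate and [D] already lie in [Dstar], and a generator y / x of the chart is absorbed
    by u x * (y / x) = u y. *)
Lemma Dstar_absorb x p : x \in s -> x != 0 ->
  coefs_in (chart x) p -> saturation Dstar (u x) (tofrac p).
Proof.
move=> xs x0; have hS : is_subring (saturation Dstar (u x)).
  by apply: saturation_subring => //; exact: Dstar_u.
apply: subring_tofrac => //.
  by apply: sub_saturation; have := Dstar_Xn 1; rewrite expr1.
move=> _ [a ha <-]; move: a ha; apply: chart_sub.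
- exact: preimage_ratC_subring.
- move=> d Dd; apply: sub_saturation; apply: Dstar_poly; apply: coefs_inC => //.
  exact: subring0.
- move=> y ys; exists 1%N; rewrite expr1 (_ : _ * _ = u y); first exact: Dstar_u.
  by rewrite mulrAC -ratCM [x * _]mulrC divfK.
Qed.

Lemma u_unit x : x \in s -> x != 0 -> u x * tofrac (x^-1 *: f) = 1.
Proof.
move=> xs x0; rewrite tofracZ ratCV mulrCA mulfVK; last exact: tofrac_f_neq0.
by rewrite mulVf // ratC_neq0.
Qed.

(** Denominators of [z] found chart by chart are glued into one polynomial [Q] such that Q / f^m is
    a unit of [Dstar]. *)
Lemma ideal_nagata_local_global J z : is_ideal Dstar J ->
  (forall R, X R -> ideal_gen (nagata R) J z) -> J z.
Proof.
move=> hJ hz; have [J1 J2 J3 J4] := hJ.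
(* Stated for all large [m], so that a single exponent can be chosen for all the charts. *)
have key x : x \in s -> x != 0 -> eventually (fun m => exists q,
    [/\ exists k, q`_k = 1, J (u x ^+ m * (tofrac q * z)) &
        forall w, w \in s -> w != 0 -> coefs_in (chart w) ((x / w) ^+ m *: q)]).
  move=> xs x0; pose N := saturation J (u x).
  have hge y m m' : J (u x ^+ m * y) -> (m <= m')%N -> J (u x ^+ m' * y).
    by apply: saturation_ge => v Jv; apply: J4 => //; exact: Dstar_u.
  have hN : poly_submod (chart x) N.
    split.
    - by exists 0%N; rewrite mulr0.
    - move=> a b [m ha] [n hb]; exists (m + n)%N; rewrite mulrDr; apply: J3.
        exact: hge ha (leq_addr _ _).
      exact: hge hb (leq_addl _ _).
    - move=> p a /(Dstar_absorb xs x0)[m hp] [n ha].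
      by exists (m + n)%N; rewrite exprD mulrACA; apply: J4.
  have JN : J `<=` N by move=> y Jy; exists 0%N; rewrite mul1r.
  have [||q [hq hk [m Jq]]] := exists_monic_coef_denominator (chart_subring x) hN JN (z := z).
  - by move=> R /(blowup_chart xs x0) XR y /J1; exact: Dstar_sub_nagata.
  - by move=> R /(blowup_chart xs x0) XR; exact: hz.
  apply: (@eventually_exists _ _ q).
  (* Finitely many coefficients of [q] and finitely many charts are involved, and a power of x / w
     absorbs each coefficient into the chart of [w]. *)
  have hev : eventually (fun m' => forall w, w \in s -> w != 0 ->
      coefs_in (chart w) ((x / w) ^+ m' *: q)).
    apply: eventually_all => w ws; have [w0|w0] := eqVneq w 0.
      by exists 0%N.
    have hxw : chart w (x / w) by exact: chart_mem.
    have [n hn] : eventually (fun n => forall k, k \in iota 0 (size q) ->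
        chart w ((x / w) ^+ n * q`_k)).
      apply: eventually_all => k _.
      have [n hn] := chart_absorb xs x0 ws w0 (hq k); exists n => n'.
      by apply: saturation_ge hn => v; exact: subringM.
    exists n => n' nn' _ k; rewrite coefZ.
    have [kq|kq] := ltnP k (size q); first by apply: hn; rewrite ?mem_iota.
    by rewrite nth_default // mulr0; exact: subring0.
  have [n hn] := hev; exists (maxn m n) => k; rewrite geq_max => /andP[mk nk].
  by split=> //; [exact: hge Jq mk|exact: hn].
have [m hm] : eventually (fun m => forall x, x \in s -> x != 0 -> exists q,
    [/\ exists k, q`_k = 1, J (u x ^+ m * (tofrac q * z)) &
        forall w, w \in s -> w != 0 -> coefs_in (chart w) ((x / w) ^+ m *: q)]).
  apply: eventually_all => x xs; have [->|x0] := eqVneq x 0; first by exists 0%N.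
  by have [m hm] := key x xs x0; exists m => n mn _; exact: hm.
have {}hm := hm m (leqnn m).
(* Since u_x^m q = x^m q / f^m, scaling each [q] by x^m gives all charts the common denominator
   f^m. *)
have [Q [JQ hQ hQs]] : exists Q, [/\ J (tofrac Q / tofrac f ^+ m * z),
    (forall w, w \in s -> w != 0 -> coefs_in (chart w) (w^-1 ^+ m *: Q)) &
    forall x, x \in s -> x != 0 -> exists k, Q`_k = x ^+ m].
  have : {subset s <= s} by [].
  (* Only the list of entries already treated varies; the condition on the charts of [w] keeps the
     whole of [s]. *)
  elim: {1 4}s => [_|x l IH xls].
    exists 0; split=> //; first by rewrite tofrac0 !mul0r.
    by move=> w _ _ k; rewrite scaler0 coef0; exact: subring0.
  have [|Q [JQ hQ hQl]] := IH; first by move=> y yl; apply: xls; rewrite inE yl orbT.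
  have [x0|x0] := eqVneq x 0.
    exists Q; split=> // y; rewrite inE => /orP[/eqP->|]; last exact: hQl.
    by rewrite x0 eqxx.
  have xs : x \in s by apply: xls; exact: mem_head.
  have [q [[k qk] Jq hq]] := hm x xs x0.
  (* The shift by [size Q] keeps the supports disjoint, so the coefficients y^m of the earlier
     entries survive and x^m appears at index [size Q + k]. *)
  exists (Q + 'X^(size Q) * (x ^+ m *: q)); split.
  - rewrite tofracD mulrDl mulrDl; apply: (J3) => //.
    rewrite (_ : _ / _ * _ = tofrac 'X^(size Q) * (u x ^+ m * (tofrac q * z))).
      by apply: (J4) => //; exact: Dstar_Xn.
    rewrite tofracM tofracZ ratCX /u expr_div_n -!mulrA; congr (_ * (_ * _)).
    by rewrite mulrCA.
  - move=> w ws w0; rewrite scalerDr scalerAr scalerA -exprMn [_ * x]mulrC.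
    apply: coefs_in_ringD => //; first exact: hQ.
    by apply: coefs_in_ringM => //; [exact: coefs_inXn|exact: hq].
  - move=> y; rewrite inE; case: eqP => [->|_] /= yl y0.
      exists (size Q + k)%N; rewrite coefD coefXnM ltnNge leq_addr /= addKn.
      by rewrite nth_default ?leq_addr // add0r coefZ qk mulr1.
    have [j Qj] := hQl y yl y0; exists j; rewrite coefD coefXnM.
    have [jQ|jQ] := ltnP j (size Q); first by rewrite addr0.
    have := expf_neq0 m y0; rewrite -Qj nth_default ?eqxx //.
have Q0 : tofrac Q != 0.
  have [x xs x0] := hs; have [k Qk] := hQs x xs x0.
  rewrite tofrac_eq0; apply/eqP => Q0; have := expf_neq0 m x0.
  by rewrite -Qk Q0 coef0 eqxx.
have fm0 := expf_neq0 m tofrac_f_neq0.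
(* The factor f^m / Q lies in [Dstar]: over the chart of [w], scaling [f] by w^-1 and [Q] by w^-m
   puts both over the chart ring, and the scaled [Q] has a coefficient 1. *)
have -> : z = (tofrac f ^+ m / tofrac Q) * (tofrac Q / tofrac f ^+ m * z).
  by rewrite mulrA mulrA (divfK Q0) (divff fm0) mul1r.
apply: J4 => // R XR; have [w [ws w0 hR]] := blowupP XR.
have [hAR [M hloc]] := loc_set_local (chart_subring w) hR.
have [_ hf _] := chart_scaled_f ws w0 hR.
have -> : tofrac f ^+ m / tofrac Q =
    tofrac (w^-1 *: f) ^+ m / tofrac (w^-1 ^+ m *: Q).
  have wm0 : ratC w^-1 ^+ m != 0 by apply: expf_neq0; apply: ratC_neq0; rewrite invr_eq0.
  by rewrite !tofracZ ratCX exprMn -mulf_div (divff wm0) mul1r.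
have hS := nagata_subring hloc.
apply: subringM => //; first exact: subringX.
apply: (nagata_polyV hloc); first by move=> k; apply: hAR; exact: hQ.
have [k Qk] := hQs w ws w0; exists k; rewrite coefZ Qk -exprMn mulVf // expr1n.
by case: hloc.
Qed.

(** * Preideals on the model and their meets over the charts *)

Lemma blowup_elt R : X R -> exists R' : X, val R' = R.
Proof. by move=> XR; exists (exist _ R (mem_set XR)). Qed.

Lemma blowup_val (R : X) : X (val R).
Proof. exact: set_mem (valP R). Qed.

Lemma chart_Aff x : x \in s -> x != 0 -> Aff D X (chart x).
Proof.
move=> xs x0; split; last exact: blowup_chart.
exists [set y / x | y in H] => //; apply: finite_image; exact: finite_seq.
Qed.

Lemma preideal_meet_ideal (I : X -> set K) A : preideal I -> is_subring A ->
  [/\ preideal_meet I A 0,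
      (forall a b, preideal_meet I A a -> preideal_meet I A b ->
        preideal_meet I A (a + b)) &
      (forall a b, A a -> preideal_meet I A b -> preideal_meet I A (a * b))].
Proof.
move=> hI hA; split.
- by move=> R _; case: (hI R).
- by move=> a b ha hb R hR; have [_ _ h _] := hI R; apply: h; [exact: ha|exact: hb].
- move=> a b ha hb R hR; have [_ _ _ h] := hI R; apply: h; last exact: hb.
  by have [hAR _] := loc_set_local hA hR; apply: hAR.
Qed.

(* If no power of x / w multiplies a into the meet over the chart of w, then some
   localization R of that chart contains (x / w)^-1, hence is also a localization
   of the chart of x, and a is not in the meet locally at R. *)
Lemma preideal_meet_absorb (I : X -> set K) x w a : ideals_on D X I ->
  x \in s -> x != 0 -> w \in s -> w != 0 ->
  preideal_meet I (chart x) a ->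
  saturation (preideal_meet I (chart w)) (x / w) a.
Proof.
move=> [hI hgen] xs x0 ws w0 ha.
have [I0 ID IM] := preideal_meet_ideal hI (chart_subring w).
have hw := chart_subring w; have hx := chart_subring x.
have hy : chart w (x / w) by exact: chart_mem.
(* The conductor of [a] into the meet; if the claim fails, it contains no power of x / w. *)
pose C := [set c | chart w c /\ preideal_meet I (chart w) (c * a)].
have hC : is_ideal (chart w) C.
  split.
  - by move=> c [].
  - by split; [exact: (subring0 hw)|rewrite mul0r].
  - by move=> b c [hb Cb] [hc Cc]; split; [exact: (subringD hw)|rewrite mulrDl; exact: ID].
  - by move=> b c hb [hc Cc]; split; [exact: (subringM hw)|rewrite -mulrA; exact: IM].
apply: contrapT => hno.
have [|P [hP CP hPy]] := exists_prime_avoiding (chart_subring w) hC hy.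
  by move=> m [_ hm]; apply: hno; exists m.
have [R0 h0] : exists R0, R0 = localization (chart w) P by exists (localization (chart w) P).
have hRw : loc_set (chart w) R0 by exists P.
have hRx : loc_set (chart x) R0.
  rewrite h0; apply: localization_transfer => //.
  - move=> b /(chart_absorb xs x0 ws w0)[m hb].
    exists ((x / w) ^+ m * b) => //; exists ((x / w) ^+ m).
      by split; [exact: (subringX _ hw)|exact: hPy].
    by rewrite mulrC mulKf // expf_neq0 // mulf_neq0 ?invr_eq0.
  - move=> b /(chart_absorb ws w0 xs x0)[m hb]; exists ((w / x) ^+ m); split=> //.
    + by apply: (subringX _ hx) => //; exact: chart_mem.
    + by rewrite -exprVn invf_div; exact: (subringX _ hw).
    + by rewrite expf_neq0 // mulf_neq0 ?invr_eq0.
have [R hR] := blowup_elt (blowup_chart xs x0 hRx).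
have := ha R; rewrite /= hR => /(_ hRx).
rewrite (hgen (chart w) R) ?hR //; last exact: chart_Aff.
have [hwR [M hloc]] := loc_set_local (chart_subring w) hRw.
have hR0 := local_at_ring hloc.
(* Elements of the extended meet have a denominator outside [P]; for [a] that denominator would lie
   in [C], hence in [P]. *)
suff hsub : ideal_gen R0 (preideal_meet I (chart w)) `<=` [set r | R0 r /\
    exists t, [/\ chart w t, ~ P t & preideal_meet I (chart w) (t * r)]].
  by move=> /hsub[_ [t [ht nt It]]]; apply: nt; apply: CP.
apply: smallest_sub; last first.
  move=> r hr; split.
    have [h _ _ _] := hI R; rewrite -hR; apply: h; apply: hr => /=.
    by rewrite hR.
  by exists 1; rewrite mul1r; split=> //; [exact: (subring1 hw)|exact: prime_ideal1 hP].
split.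
- by move=> r [].
- split; first exact: (subring0 hR0).
  by exists 1; rewrite mulr0; split=> //; [exact: (subring1 hw)|exact: prime_ideal1 hP].
- move=> b c [hb [t [ht nt It]]] [hc [t' [ht' nt' It']]]; split; first exact: (subringD hR0).
  exists (t * t'); split; [exact: (subringM hw)|exact: prime_idealM hP _ _ _ _|].
  rewrite (_ : _ * _ = t' * (t * b) + t * (t' * c)); last by ring.
  by apply: ID; apply: IM.
- move=> b c hb [hc [t [ht nt It]]]; split; first exact: (subringM hR0).
  move: hb; rewrite h0 => -[d hd [t' [ht' nt'] <-]].
  exists (t' * t); split; [exact: (subringM hw)|exact: prime_idealM hP _ _ _ _|].
  rewrite (_ : _ * _ = d * (t * c)); first exact: IM.
  by field; exact: prime_neq0 hP nt'.
Qed.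

(** * From ideals on the model to relevant ideals of [Dstar] *)

Lemma ideal_to_nagataP (I : X -> set K) z : ideal_to_nagata X I z <->
  forall R : X, ideal_gen (nagata (val R)) (@ratC K @` I R) z.
Proof. by split=> [h R|h R _]; exact: h. Qed.

Lemma preideal_gen_ideal (I : X -> set K) (R : X) : preideal I ->
  is_ideal (nagata (val R)) (ideal_gen (nagata (val R)) (@ratC K @` I R)).
Proof.
move=> hI; have [M hloc] := blowup_local (blowup_val R).
apply: is_ideal_gen; first exact: nagata_subring hloc.
exact: (sub_ratC_nagata hloc (hI R)).
Qed.

Lemma ideal_to_nagata_ideal (I : X -> set K) : preideal I ->
  is_ideal Dstar (ideal_to_nagata X I).
Proof.
move=> hI; split.
- move=> z /ideal_to_nagataP hz R XR; have [R' <-] := blowup_elt XR.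
  by have [h _ _ _] := preideal_gen_ideal R' hI; exact: h (hz R').
- by move=> R _; case: (preideal_gen_ideal R hI).
- move=> a b ha hb R hR; have [_ _ h _] := preideal_gen_ideal R hI.
  by apply: h; [exact: ha|exact: hb].
- move=> a b ha hb R hR; have [_ _ _ h] := preideal_gen_ideal R hI.
  by apply: h; [exact: ha (blowup_val R)|exact: hb].
Qed.

(** Over the chart of [w], u_x^m a is (x / w)^m a divided by a unit of R(t), and one large [m] puts
    (x / w)^m a in the meet over every chart. *)
Lemma ideal_to_nagata_absorb (I : X -> set K) x a : ideals_on D X I -> x \in s -> x != 0 ->
  preideal_meet I (chart x) a ->
  saturation (ideal_to_nagata X I) (u x) (ratC a).
Proof.
move=> hI xs x0 ha; have [hpre _] := hI.
have [m hm] : eventually (fun m => forall w, w \in s -> w != 0 ->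
    preideal_meet I (chart w) ((x / w) ^+ m * a)).
  apply: eventually_all => w ws; have [w0|w0] := eqVneq w 0; first by exists 0%N.
  have [m hm] := preideal_meet_absorb hI xs x0 ws w0 ha; exists m => n mn _.
  apply: saturation_ge hm mn => b.
  have [_ _ h] := preideal_meet_ideal hpre (chart_subring w).
  by apply: h; exact: chart_mem.
exists m; apply/ideal_to_nagataP => R.
have [w [ws w0 hR]] := blowupP (blowup_val R).
have [_ _ hf] := chart_scaled_f ws w0 hR.
have [M hloc] := blowup_local (blowup_val R).
have [_ _ _ J4] := preideal_gen_ideal R hpre.
rewrite (u_chart _ w0) expr_div_n mulrAC -ratCX -ratCM mulrC; apply: J4.
  by rewrite -exprVn; apply: subringX => //; exact: nagata_subring hloc.
apply: sub_gen_smallest; exists ((x / w) ^+ m * a) => //.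
exact: (hm m (leqnn m) w ws w0).
Qed.

(** The ideal [I R] is generated by its meet over one chart containing [R], so only elements [a] of
    that meet matter; u_x^m a lies in the ideal of [Dstar], and [u x] is a unit of R(t). *)
Lemma ideal_to_nagata_ext (I : X -> set K) (R : X) : ideals_on D X I ->
  ideal_gen (nagata (val R)) (ideal_to_nagata X I) =
  ideal_gen (nagata (val R)) (@ratC K @` I R).
Proof.
move=> hI; have [hpre hgen] := hI.
have [M hloc] := blowup_local (blowup_val R).
have hS := nagata_subring hloc.
have [J1 _ _ _] := ideal_to_nagata_ideal hpre.
have JR : ideal_to_nagata X I `<=` nagata (val R).
  by move=> z /J1; exact: (Dstar_sub_nagata (blowup_val R)).
have hJ := is_ideal_gen hS JR; have [_ G0 GD GM] := hJ.
apply/seteqP; split.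
  apply: smallest_sub; first exact: preideal_gen_ideal.
  by move=> z /ideal_to_nagataP.
apply: smallest_sub => // _ [r hr <-].
have [x [xs x0 hR]] := blowupP (blowup_val R).
suff : I R `<=` [set r | val R r /\
    ideal_gen (nagata (val R)) (ideal_to_nagata X I) (ratC r)] by move=> /(_ r hr)[].
rewrite (hgen (chart x) R) //; last exact: chart_Aff.
have hvR := local_at_ring hloc.
apply: smallest_sub.
  split.
  - by move=> c [].
  - by split; [exact: subring0|rewrite /ratC tofrac0].
  - move=> b c [hb Gb] [hc Gc]; split; first exact: subringD.
    by rewrite /ratC polyCD tofracD; exact: GD.
  - move=> b c hb [hc Gc]; split; first exact: subringM.
    by rewrite ratCM; apply: GM => //; exact: (nagataC hloc).
move=> a ha; split; first by have [h _ _ _] := hpre R; apply: h; exact: ha.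
have [m hm] := ideal_to_nagata_absorb hI xs x0 ha.
have [_ hf _] := chart_scaled_f xs x0 hR.
rewrite -[ratC a]mul1r -(expr1n _ m) -(u_unit xs x0) exprMn mulrAC mulrC.
by apply: GM; [exact: subringX|exact: sub_gen_smallest].
Qed.

Lemma nagata_to_idealK : {in ideals_on D X,
  cancel (ideal_to_nagata X) (nagata_to_ideal X)}.
Proof.
move=> I /set_mem hI; apply/funext => R; rewrite /nagata_to_ideal.
rewrite ideal_to_nagata_ext //; have [hpre _] := hI.
have [M hloc] := blowup_local (blowup_val R); rewrite (ideal_gen_ratC hloc (hpre R)).
have [I1 I2 _ _] := hpre R.
apply/seteqP; split=> [c [/= hc Rc]|c Ic]; first exact: (ext_nagata_ratC hloc (hpre R)).
split; last exact: I1.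
by apply: (ext_nagata_poly hloc); exact: coefs_inC.
Qed.

(** The extension to R(t) is the one of [I R], hence generated by elements of [R]. *)
Lemma ideal_to_nagata_relevant :
  set_fun (ideals_on D X) (relevant_ideals X) (ideal_to_nagata X).
Proof.
move=> I hI; have [hpre _] := hI; split; first exact: ideal_to_nagata_ideal.
move=> R0 /blowup_elt[R <-]; have [M hloc] := blowup_local (blowup_val R).
rewrite /relevant_nagata ideal_to_nagata_ext //.
have hG := preideal_gen_ideal R hpre; split=> //.
have hS := nagata_subring hloc; have [I1 _ _ _] := hpre R; have [G1 _ _ _] := hG.
apply/seteqP; split; apply: smallest_sub => //.
  by apply: is_ideal_gen => // z [/G1].
move=> _ [c hc <-]; apply: sub_gen_smallest; split.
  by apply: sub_gen_smallest; exists c.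
by exists c => //; exact: I1.
Qed.

(** * From relevant ideals of [Dstar] back to ideals on the model *)

Lemma nagata_to_ideal_preideal J : is_ideal Dstar J ->
  preideal (nagata_to_ideal X J).
Proof.
move=> [J1 _ _ _] R; have [M hloc] := blowup_local (blowup_val R).
have hR := local_at_ring hloc.
have [|_ G0 GD GM] := @is_ideal_gen _ (nagata (val R)) J (nagata_subring hloc).
  by move=> z /J1; exact: (Dstar_sub_nagata (blowup_val R)).
split.
- by move=> c [].
- by split; [rewrite /= /ratC tofrac0; exact: G0|exact: (subring0 hR)].
- move=> b c [/= hb Rb] [/= hc Rc]; split; last exact: subringD.
  by rewrite /= /ratC polyCD tofracD; exact: GD.
- move=> b c hb [/= hc Rc]; split; last exact: subringM.
  by rewrite /= ratCM; apply: GM => //; exact: (nagataC hloc).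
Qed.

Lemma relevant_gen J (R : X) : relevant_ideals X J ->
  ideal_gen (nagata (val R)) (@ratC K @` nagata_to_ideal X J R) =
  ideal_gen (nagata (val R)) J.
Proof.
move=> [hJ hrel]; have [_ E] := hrel _ (blowup_val R).
rewrite [RHS]E; congr ideal_gen; apply/seteqP; split.
  by move=> _ [c [/= hc Rc] <-]; split=> //; exists c.
by move=> z [hz [c Rc E']]; exists c => //; split=> //=; rewrite E'.
Qed.

(** For R = A_P, write an element of [I R] as b / t over [A]. A polynomial [q] over [A] with a
    coefficient outside [P] multiplies [b] into the extension of [J] at every localization of [A].
    By relevance and McCoy's theorem that coefficient multiplies [b] into the meet over [A], and it
    is a unit of [R]. *)
Lemma nagata_to_ideal_ideals :
  set_fun (relevant_ideals X) (ideals_on D X) (nagata_to_ideal X).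
Proof.
move=> J hJr; have [hJ hrel] := hJr; have hpre := nagata_to_ideal_preideal hJ.
split=> // A R [hA hAX] hAR; have [J1 _ _ _] := hJ.
have hAs : is_subring A by case: hA => G _ ->; exact: subring_adjoin.
set I := nagata_to_ideal X J in hpre *.
apply/seteqP; split; last by apply: smallest_sub => // a; exact.
have JS R' : X R' -> J `<=` nagata R'.
  by move=> XR z /J1; exact: (Dstar_sub_nagata XR).
have gen_ideal R' : loc_set A R' ->
    is_subring (nagata R') /\ is_ideal (nagata R') (ideal_gen (nagata R') J).
  move=> /[dup] /(loc_set_local hAs)[_ [M hloc]] /hAX XR.
  by have hS := nagata_subring hloc; split=> //; apply: is_ideal_gen => //; exact: JS.
pose N := \bigcap_(R' in loc_set A) ideal_gen (nagata R') J.
have hN : poly_submod A N.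
  split.
  - by move=> R' /gen_ideal[_ []].
  - move=> b c hb hc R' hR; have [_ [_ _ h _]] := gen_ideal R' hR.
    by apply: h; [exact: hb|exact: hc].
  - move=> p b hp hb R' hR; have [_ [_ _ _ h]] := gen_ideal R' hR.
    apply: h; last exact: hb.
    have [hAR' [M hloc]] := loc_set_local hAs hR.
    by apply: (nagata_poly hloc) => k; exact: hAR'.
have JN : J `<=` N by move=> z Jz R' _; exact: sub_gen_smallest.
have [hAv [M hloc]] := loc_set_local hAs hAR.
have [Rv _ _ IMul] := hpre R.
have meetR : preideal_meet I A `<=` val R by move=> a ha; apply: Rv; exact: ha.
have [_ _ _ GM] := is_ideal_gen (local_at_ring hloc) meetR.
move=> a Ia.
have [P hP E] := hAR; have := Rv _ Ia; rewrite -E => -[b hb [t [ht nt] Ea]].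
have Ib : I R b.
  have -> : b = t * a by rewrite -Ea mulrC divfK // (prime_neq0 hP nt).
  by apply: IMul => //; exact: hAv.
have [Jb _] := Ib.
have [q [hq [k nk] Nq]] : exists q, [/\ coefs_in A q, has_unit_coef P q &
    N (tofrac q * ratC b)].
  apply: (ideal_gen_nagata_denominator hAs hP hN JN); rewrite E; last exact: Jb.
  exact: JS (blowup_val R).
(* By relevance the extension of [J] to R'(t) is that of [I R'], so every coefficient of [q * b]
   lies in [I R']. *)
have hqb : preideal_meet I A (q`_k * b).
  move=> R' hR'; have [hAR' [M' hloc']] := loc_set_local hAs hR'.
  have := Nq _ hR'; rewrite -(relevant_gen R' hJr) (ideal_gen_ratC hloc' (hpre R')).
  rewrite /ratC -tofracM => /(ext_nagata_coefs hloc' (hpre R')) h.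
  have := h _ k; rewrite coefMC; apply=> j; rewrite coefMC.
  by apply: hAR'; exact: subringM.
have -> : a = (t * q`_k)^-1 * (q`_k * b).
  by rewrite -Ea; field; rewrite (prime_neq0 hP nt) (prime_neq0 hP nk).
rewrite E; apply: GM; last exact: sub_gen_smallest.
rewrite -E; apply: localizationV => //; first exact: subringM.
exact: prime_idealM hP _ _ _ _.
Qed.

(** By relevance the contractions extend back to J R(t) for each [R], and the intersection of these
    extensions is [J]. *)
Lemma ideal_to_nagataK : {in relevant_ideals X,
  cancel (nagata_to_ideal X) (ideal_to_nagata X)}.
Proof.
move=> J /set_mem hJ; have [hJi _] := hJ; apply/seteqP; split.
  move=> z /ideal_to_nagataP hz; apply: ideal_nagata_local_global => // R0 XR.
  by have [R <-] := blowup_elt XR; rewrite -(relevant_gen R hJ).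
move=> z Jz; apply/ideal_to_nagataP => R; rewrite (relevant_gen R hJ).
exact: sub_gen_smallest.
Qed.

End Model.
End Nagata.

Theorem theorem4p6 (K : fieldType) (D : set K) (X : set (set K))
    (hD : is_subring D) (hX : projective_model D X) :
  [/\ set_bij (ideals_on D X) (relevant_ideals X) (ideal_to_nagata X),
      set_fun (relevant_ideals X) (ideals_on D X) (nagata_to_ideal X),
      {in ideals_on D X, cancel (ideal_to_nagata X) (nagata_to_ideal X)} &
      {in relevant_ideals X, cancel (nagata_to_ideal X) (ideal_to_nagata X)}].
Proof.
have [_ [H [/finite_seqP[s ->] [x [xs /eqP x0]] ->]]] := hX.
have hs : exists2 x, x \in s & x != 0 by exists x.
have hfun := @ideal_to_nagata_relevant _ D s hs.
have hinv := @nagata_to_ideal_ideals _ D s.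
have hcan := @nagata_to_idealK _ D s hs.
have hcan' := ideal_to_nagataK hs hD.
split=> //; split=> //.
- by move=> I I' hI hI' E; rewrite -(hcan I hI) E hcan.
- by move=> J hJ; exists (nagata_to_ideal _ J); [exact: hinv|rewrite hcan' // inE].
Qed.
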